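(* Let $q=e^{2\pi i/3}$ and let $A$ be the quantum plane with its first order differential calculus $(A^1,d)$ and bimodule automorphism $\tau$ of $A^1\otimes A^1$ as described in the context. Let $g$ be a $\tau$-symmetric metric on $A^1$, $\nabla^L$ a left connection on $A^1$ and $\nabla^R$ a right connection on $A^1$. Then the metric compatibility condition $$dg(\zeta,\rho)=\check g(\nabla^L\zeta,\rho)+\hat g(\zeta,\nabla^R\rho)$$ holds for all $\zeta,\rho\in Z(A^1)$ if and only if it holds for all $\zeta,\rho\in A^1$.
   Context: Unadorned $\otimes$ is the tensor product over $\mathbb{C}$. $A$ is the unital complex algebra generated by $x,y$ with the relation $xy=qyx$. $A^1$ is the $A$-bimodule generated by $\xi=dx$ and $\eta=dy$ subject to $$x\xi=q^2\xi x,\quad x\eta=q\eta x+(q^2-1)\xi y,\quad y\xi=q\xi y,\quad y\eta=q^2\eta y;$$ it is free with basis $\{\xi,\eta\}$ both as a left and as a right $A$-module, and $d:A\to A^1$ is the derivation with $dx=\xi$, $dy=\eta$. $Z(A^1)=\{\zeta\in A^1: a\zeta=\zeta a\ \ \forall a\in A\}$ is the centre of the bimodule $A^1$. $\tau:A^1\otimes A^1\to A^1\otimes A^1$ is the bimodule automorphism (with respect to $a(\zeta\otimes\rho)b=a\zeta\otimes\rho b$) determined by $$\tau(\xi\otimes\xi)=\xi\otimes\xi,\quad \tau(\xi\otimes\eta)=q\,\eta\otimes\xi,\quad \tau(\eta\otimes\xi)=q\,\xi\otimes\eta-(q^2-1)\,\eta\otimes\xi,\quad \tau(\eta\otimes\eta)=\eta\otimes\eta.$$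 A $\tau$-symmetric metric on $A^1$ is a linear map $g:A^1\otimes A^1\to A$ (neither nondegeneracy nor middle-linearity is required) such that $g(a\zeta,\rho b)=a\,g(\zeta,\rho)\,b$ for all $\zeta,\rho\in A^1$, $a,b\in A$, and $g\circ\tau=g$. Its extensions $\check g:A^1\otimes_AA^1\otimes A^1\to A^1$ and $\hat g:A^1\otimes A^1\otimes_AA^1\to A^1$ are given by $$\check g(\alpha\otimes_A\zeta,\rho)=\alpha\,g(\zeta,\rho),\qquad \hat g(\zeta,\rho\otimes_A\alpha)=g(\zeta,\rho)\,\alpha,\qquad \alpha,\zeta,\rho\in A^1.$$ A left connection on $A^1$ is a linear map $\nabla^L:A^1\to A^1\otimes_AA^1$ with $\nabla^L(a\zeta)=da\otimes_A\zeta+a\nabla^L\zeta$; a right connection is a linear map $\nabla^R:A^1\to A^1\otimes_AA^1$ with $\nabla^R(\zeta a)=(\nabla^R\zeta)a+\zeta\otimes_Ada$ (for all $a\in A$, $\zeta\in A^1$). *)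

(* Defs.v *)
From HB Require Import structures.
From mathcomp Require Import all_boot all_order all_algebra generic_quotient.
From mathcomp Require Import complex.
From mathcomp Require Import boolp reals sequences trigo.

Set Implicit Arguments.
Unset Strict Implicit.
Unset Printing Implicit Defensive.

Import GRing.Theory.
Local Open Scope ring_scope.
Local Open Scope quotient_scope.

Definition cexp (R : realType) (z : R[i]) : R[i] :=
  (expR (complex.Re z) * cos (complex.Im z)
     +i* (expR (complex.Re z) * sin (complex.Im z)))%C.

(* The two actions of A extend the K-linear structure, so that K acts
   in the same way on either side. *)
HB.mixin Record isBimodule (K : comNzRingType) (A : algType K) (M : Type)
    of GRing.Lmodule K M := {
  lact : A -> M -> M;
  ract : M -> A -> M;
  lactDl : forall a b m, lact (a + b) m = lact a m + lact b m;
  lactDr : forall a m n, lact a (m + n) = lact a m + lact a n;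
  lactA : forall a b m, lact a (lact b m) = lact (a * b) m;
  ractDl : forall m n a, ract (m + n) a = ract m a + ract n a;
  ractDr : forall m a b, ract m (a + b) = ract m a + ract m b;
  ractA : forall m a b, ract (ract m a) b = ract m (a * b);
  lact_ract : forall a m b, lact a (ract m b) = ract (lact a m) b;
  lact_scal : forall (c : K) m, lact c%:A m = c *: m;
  ract_scal : forall m (c : K), ract m c%:A = c *: m }.

#[short(type="bimodType")]
HB.structure Definition Bimodule (K : comNzRingType) (A : algType K) :=
  {M of isBimodule K A M & GRing.Lmodule K M}.

Notation "a ▷ m" := (lact a m) (at level 38, right associativity) : ring_scope.
Notation "m ◁ a" := (ract m a) (at level 37, left associativity) : ring_scope.

Section BimoduleTheory.
Context (K : comNzRingType) (A : algType K) (M : bimodType A).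

Lemma lact1 (m : M) : (1 : A) ▷ m = m.
Proof. by rewrite -(scale1r (1 : A)) lact_scal scale1r. Qed.

Lemma ract1 (m : M) : m ◁ (1 : A) = m.
Proof. by rewrite -(scale1r (1 : A)) ract_scal scale1r. Qed.

Lemma lactZ (c : K) (a : A) (m : M) : c *: (a ▷ m) = a ▷ (c *: m).
Proof. by rewrite -!lact_scal !lactA mulr_algl mulr_algr. Qed.

Lemma lactZl (c : K) (a : A) (m : M) : c *: (a ▷ m) = (c *: a) ▷ m.
Proof. by rewrite -lact_scal lactA mulr_algl. Qed.

Lemma ractZ (c : K) (a : A) (m : M) : c *: (m ◁ a) = (c *: m) ◁ a.
Proof. by rewrite -!lact_scal lact_ract. Qed.

Lemma ractZr (c : K) (a : A) (m : M) : c *: (m ◁ a) = m ◁ (c *: a).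
Proof. by rewrite -ract_scal ractA mulr_algr. Qed.

Lemma lact0r (a : A) : a ▷ (0 : M) = 0.
Proof. by apply: (@addIr _ (a ▷ 0)); rewrite -lactDr !add0r. Qed.

Lemma lact0l (m : M) : (0 : A) ▷ m = 0.
Proof. by apply: (@addIr _ (0 ▷ m)); rewrite -lactDl !add0r. Qed.

Lemma ract0l (a : A) : (0 : M) ◁ a = 0.
Proof. by apply: (@addIr _ (0 ◁ a)); rewrite -ractDl !add0r. Qed.

Lemma ract0r (m : M) : m ◁ (0 : A) = 0.
Proof. by apply: (@addIr _ (m ◁ 0)); rewrite -ractDr !add0r. Qed.

Definition bimod_center (m : M) : Prop := forall a : A, a ▷ m = m ◁ a.

End BimoduleTheory.

(* The tensor product of a right S-module M (action [ra]) and a left S-module N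
   (action [la]): the abelian group generated by the symbols m ⊗ n subject to
   biadditivity and (m.s) ⊗ n = m ⊗ (s.n). *)
Section TensorProduct.
Context (M N : zmodType) (S : Type) (ra : M -> S -> M) (la : S -> N -> N).

Inductive tterm : Type :=
| TPure of M & N | TZero | TAdd of tterm & tterm | TOpp of tterm.

Inductive tcong : tterm -> tterm -> Prop :=
| tc_refl t : tcong t t
| tc_sym s t : tcong s t -> tcong t s
| tc_trans s t u : tcong s t -> tcong t u -> tcong s u
| tc_add s s' t t' :
    tcong s s' -> tcong t t' -> tcong (TAdd s t) (TAdd s' t')
| tc_opp s s' : tcong s s' -> tcong (TOpp s) (TOpp s')
| tc_addA s t u : tcong (TAdd s (TAdd t u)) (TAdd (TAdd s t) u)
| tc_addC s t : tcong (TAdd s t) (TAdd t s)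
| tc_add0 t : tcong (TAdd TZero t) t
| tc_addN t : tcong (TAdd (TOpp t) t) TZero
| tc_Dl m m' n : tcong (TPure (m + m') n) (TAdd (TPure m n) (TPure m' n))
| tc_Dr m n n' : tcong (TPure m (n + n')) (TAdd (TPure m n) (TPure m n'))
| tc_bal m s n : tcong (TPure (ra m s) n) (TPure m (la s n)).

HB.instance Definition _ := gen_eqMixin tterm.
HB.instance Definition _ := gen_choiceMixin tterm.

Definition teq : rel tterm := fun s t => `[< tcong s t >].

Lemma teq_refl : reflexive teq.
Proof. by move=> t; apply/asboolP; apply: tc_refl. Qed.
Lemma teq_sym : symmetric teq.
Proof. by move=> s t; apply/asboolP/asboolP; apply: tc_sym. Qed.
Lemma teq_trans : transitive teq.
Proof.
by move=> t s u /asboolP st /asboolP tu; apply/asboolP; apply: tc_trans tu.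
Qed.
Canonical teq_equiv := EquivRel teq teq_refl teq_sym teq_trans.

Definition tensor := {eq_quot teq}.
HB.instance Definition _ := Choice.on tensor.
HB.instance Definition _ := EqQuotient.on tensor.

Lemma tensor_eqP s t : tcong s t <-> \pi_tensor s = \pi_tensor t.
Proof.
split=> [st|st]; first by apply/eqmodP/asboolP.
by move/eqmodP: st => /asboolP.
Qed.

Definition tadd (u v : tensor) : tensor :=
  \pi_tensor (TAdd (repr u) (repr v)).
Definition topp (u : tensor) : tensor := \pi_tensor (TOpp (repr u)).

Lemma taddE s t : tadd (\pi_tensor s) (\pi_tensor t) = \pi_tensor (TAdd s t).
Proof. by apply/tensor_eqP/tc_add; apply/tensor_eqP; rewrite reprK. Qed.

Lemma toppE s : topp (\pi_tensor s) = \pi_tensor (TOpp s).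
Proof. by apply/tensor_eqP/tc_opp; apply/tensor_eqP; rewrite reprK. Qed.

Lemma tensor_addA : associative tadd.
Proof.
elim/quotW=> s; elim/quotW=> t; elim/quotW=> u.
by rewrite (taddE t u) (taddE s t) !taddE; apply/tensor_eqP/tc_addA.
Qed.
Lemma tensor_addC : commutative tadd.
Proof.
by elim/quotW=> s; elim/quotW=> t; rewrite !taddE; apply/tensor_eqP/tc_addC.
Qed.
Lemma tensor_add0 : left_id (\pi_tensor TZero) tadd.
Proof. by elim/quotW=> s; rewrite taddE; apply/tensor_eqP/tc_add0. Qed.
Lemma tensor_addN : left_inverse (\pi_tensor TZero) topp tadd.
Proof. by elim/quotW=> s; rewrite (toppE s) taddE; apply/tensor_eqP/tc_addN. Qed.

HB.instance Definition _ := GRing.isZmodule.Build tensor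
  tensor_addA tensor_addC tensor_add0 tensor_addN.

Definition tpure (m : M) (n : N) : tensor := \pi_tensor (TPure m n).

Lemma tpureDl m m' n : tpure (m + m') n = tpure m n + tpure m' n.
Proof. by rewrite /tpure [RHS]taddE; apply/tensor_eqP/tc_Dl. Qed.
Lemma tpureDr m n n' : tpure m (n + n') = tpure m n + tpure m n'.
Proof. by rewrite /tpure [RHS]taddE; apply/tensor_eqP/tc_Dr. Qed.
Lemma tpure_bal m s n : tpure (ra m s) n = tpure m (la s n).
Proof. by apply/tensor_eqP/tc_bal. Qed.

Lemma tensor_ind (P : tensor -> Prop) :
  (forall m n, P (tpure m n)) -> P 0 ->
  (forall u v, P u -> P v -> P (u + v)) -> (forall u, P u -> P (- u)) ->
  forall u, P u.
Proof.
move=> Pp P0 PD PN; elim/quotW; elim=> [m n||s Ps t Pt|s Ps]; first exact: Pp.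
- exact: P0.
- by rewrite -taddE; apply: PD.
- by rewrite -toppE; apply: PN.
Qed.

(* The additive map m ⊗ n |-> f m n. It is meaningful only for a balanced f,
   see [tliftE] and [tliftD]. *)
Section Lift.
Context (V : zmodType) (f : M -> N -> V).

Fixpoint teval (t : tterm) : V :=
  match t with
  | TPure m n => f m n
  | TZero => 0
  | TAdd s t => teval s + teval t
  | TOpp s => - teval s
  end.

Definition tlift (u : tensor) : V := teval (repr u).

Record balanced : Prop := Balanced {
  balancedDl : forall m m' n, f (m + m') n = f m n + f m' n;
  balancedDr : forall m n n', f m (n + n') = f m n + f m n';
  balancedS : forall m s n, f (ra m s) n = f m (la s n) }.

Hypothesis fP : balanced.

Lemma tlift_pi t : tlift (\pi_tensor t) = teval t.
Proof.
have H s s' : tcong s s' -> teval s = teval s'.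
  elim=> //=.
  - by move=> ? ? ? _ -> _ ->.
  - by move=> ? ? ? ? _ -> _ ->.
  - by move=> ? ? _ ->.
  - by move=> *; rewrite addrA.
  - by move=> *; rewrite addrC.
  - by move=> *; rewrite add0r.
  - by move=> *; rewrite addNr.
  - by move=> *; rewrite (balancedDl fP).
  - by move=> *; rewrite (balancedDr fP).
  - by move=> *; rewrite (balancedS fP).
by apply: H; apply/tensor_eqP; rewrite reprK.
Qed.

Lemma tliftE m n : tlift (tpure m n) = f m n.
Proof. exact: tlift_pi. Qed.

Lemma tliftD u v : tlift (u + v) = tlift u + tlift v.
Proof.
elim/quotW: u => s; elim/quotW: v => t.
by rewrite [_ + _]taddE !tlift_pi.
Qed.

Lemma tliftN u : tlift (- u) = - tlift u.
Proof. by elim/quotW: u => s; rewrite [- _ in LHS]toppE !tlift_pi. Qed.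

Lemma tlift0 : tlift 0 = 0.
Proof. exact: tlift_pi. Qed.

End Lift.

Lemma additive_eq (V : zmodType) (F G : tensor -> V) :
  {morph F : u v / u + v} -> {morph G : u v / u + v} ->
  (forall m n, F (tpure m n) = G (tpure m n)) -> F =1 G.
Proof.
move=> FD GD FG.
have F0 : F 0 = 0 by apply: (@addIr _ (F 0)); rewrite -FD !add0r.
have G0 : G 0 = 0 by apply: (@addIr _ (G 0)); rewrite -GD !add0r.
apply: tensor_ind => [//||u v Fu Fv|u Fu]; first by rewrite F0 G0.
- by rewrite FD GD Fu Fv.
- apply: (@addIr _ (F u)); rewrite -FD addNr F0 Fu -GD addNr G0 //.
Qed.

End TensorProduct.

(* The outer K- and A-actions on a tensor product M ⊗_S N of bimodules, when
   these commute with the actions of S. *)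
Section OuterActions.
Context (K : comNzRingType) (A : algType K) (M N : bimodType A).
Context (S : Type) (ra : M -> S -> M) (la : S -> N -> N).
Local Notation T := (tensor ra la).

Definition touter_scale (c : K) : T -> T :=
  tlift (fun m n => tpure ra la (c *: m) n).
Definition touter_lact (a : A) : T -> T :=
  tlift (fun m n => tpure ra la (a ▷ m) n).
Definition touter_ract (u : T) (a : A) : T :=
  tlift (fun m n => tpure ra la m (n ◁ a)) u.

Record outer_compat : Prop := OuterCompat {
  outer_scale : forall c m s, c *: ra m s = ra (c *: m) s;
  outer_lact : forall (a : A) m s, a ▷ ra m s = ra (a ▷ m) s;
  outer_ract : forall s n (a : A), la s n ◁ a = la s (n ◁ a);
  outer_scal : forall (c : K) m n, tpure ra la (c *: m) n = tpure ra la m (c *: n) }.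

Hypothesis H : outer_compat.

Lemma scale_bal c : balanced ra la (fun m n => tpure ra la (c *: m) n).
Proof.
split=> [m m' n|m n n'|m s n]; first by rewrite scalerDr tpureDl.
- by rewrite tpureDr.
- by rewrite (outer_scale H) tpure_bal.
Qed.
Lemma lact_bal a : balanced ra la (fun m n => tpure ra la (a ▷ m) n).
Proof.
split=> [m m' n|m n n'|m s n]; first by rewrite lactDr tpureDl.
- by rewrite tpureDr.
- by rewrite (outer_lact H) tpure_bal.
Qed.
Lemma ract_bal a : balanced ra la (fun m n => tpure ra la m (n ◁ a)).
Proof.
split=> [m m' n|m n n'|m s n]; first by rewrite tpureDl.
- by rewrite ractDl tpureDr.
- by rewrite (outer_ract H) tpure_bal.
Qed.

Definition scaleE c := tliftE (scale_bal c).
Definition touter_lactE a := tliftE (lact_bal a).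
Definition touter_ractE u a := tliftE (ract_bal a) u.

Lemma tscaleDr c : {morph touter_scale c : u v / u + v}.
Proof. exact: tliftD (scale_bal c). Qed.
Lemma tlactDr a : {morph touter_lact a : u v / u + v}.
Proof. exact: tliftD (lact_bal a). Qed.
Lemma tractDl a : {morph touter_ract^~ a : u v / u + v}.
Proof. exact: tliftD (ract_bal a). Qed.

Lemma tscaleA c c' u : touter_scale c (touter_scale c' u) = touter_scale (c * c') u.
Proof.
move: u; apply: additive_eq => [u v|u v|m n]; rewrite ?tscaleDr //.
by rewrite /touter_scale !scaleE scalerA.
Qed.
Lemma tscale1 : left_id 1 touter_scale.
Proof.
apply: additive_eq => [u v|u v|m n]; rewrite ?tscaleDr //.
by rewrite /touter_scale !scaleE scale1r.
Qed.
Lemma tscaleDl u : {morph touter_scale^~ u : c c' / c + c'}.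
Proof.
move=> c c'; move: u.
apply: additive_eq => [u v|u v|m n]; rewrite ?tscaleDr // 1?addrACA //.
by rewrite /touter_scale !scaleE scalerDl tpureDl.
Qed.
Lemma tlactDl a b u : touter_lact (a + b) u = touter_lact a u + touter_lact b u.
Proof.
move: u; apply: additive_eq => [u v|u v|m n]; rewrite ?tlactDr // 1?addrACA //.
by rewrite /touter_lact !touter_lactE lactDl tpureDl.
Qed.
Lemma tlactA a b u : touter_lact a (touter_lact b u) = touter_lact (a * b) u.
Proof.
move: u; apply: additive_eq => [u v|u v|m n]; rewrite ?tlactDr //.
by rewrite /touter_lact !touter_lactE lactA.
Qed.
Lemma tractDr u a b : touter_ract u (a + b) = touter_ract u a + touter_ract u b.
Proof.
move: u; apply: additive_eq => [u v|u v|m n]; rewrite ?tractDl // 1?addrACA //.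
by rewrite /touter_ract !touter_ractE ractDr tpureDr.
Qed.
Lemma tractA u a b : touter_ract (touter_ract u a) b = touter_ract u (a * b).
Proof.
move: u; apply: additive_eq => [u v|u v|m n]; rewrite ?tractDl //.
by rewrite /touter_ract !touter_ractE ractA.
Qed.
Lemma tlact_ract a u b :
  touter_lact a (touter_ract u b) = touter_ract (touter_lact a u) b.
Proof.
move: u; apply: additive_eq => [u v|u v|m n]; rewrite ?tractDl ?tlactDr ?tractDl //.
by rewrite /touter_lact /touter_ract !(touter_lactE, touter_ractE).
Qed.
Lemma tlact_scal c u : touter_lact c%:A u = touter_scale c u.
Proof.
move: u; apply: additive_eq => [u v|u v|m n]; rewrite ?tlactDr ?tscaleDr //.
by rewrite /touter_lact /touter_scale touter_lactE scaleE lact_scal.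
Qed.
Lemma tract_scal u c : touter_ract u c%:A = touter_scale c u.
Proof.
move: u; apply: additive_eq => [u v|u v|m n]; rewrite ?tractDl ?tscaleDr //.
by rewrite /touter_ract /touter_scale touter_ractE scaleE ract_scal outer_scal.
Qed.

End OuterActions.

Section BimoduleTensors.
Context (K : comNzRingType) (A : algType K) (M N : bimodType A).

Definition scaler (m : M) (c : K) : M := c *: m.

Definition tensK : Type := tensor scaler (@GRing.scale K N).
Definition pureK (m : M) (n : N) : tensK := tpure _ _ m n.
HB.instance Definition _ := GRing.Zmodule.on tensK.

Lemma tensK_compat : outer_compat scaler (@GRing.scale K N).
Proof.
split=> [c m s|a m s|s n a|c m n]; rewrite /scaler.
- by rewrite !scalerA mulrC.
- by rewrite lactZ.
- by rewrite ractZ.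
- exact: (tpure_bal scaler _ m c n).
Qed.

HB.instance Definition _ := GRing.Zmodule_isLmodule.Build K tensK
  (tscaleA tensK_compat) (tscale1 tensK_compat)
  (tscaleDr tensK_compat) (tscaleDl tensK_compat).
HB.instance Definition _ := isBimodule.Build K A tensK
  (tlactDl tensK_compat) (tlactDr tensK_compat) (tlactA tensK_compat)
  (fun u v a => tractDl tensK_compat a u v)
  (tractDr tensK_compat) (tractA tensK_compat) (tlact_ract tensK_compat)
  (tlact_scal tensK_compat) (tract_scal tensK_compat).

Definition tensA : Type := tensor (@ract K A M) (@lact K A N).
Definition pureA (m : M) (n : N) : tensA := tpure _ _ m n.
HB.instance Definition _ := GRing.Zmodule.on tensA.

Lemma tensA_compat : outer_compat (@ract K A M) (@lact K A N).
Proof.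
split=> [c m s|a m s|s n a|c m n].
- by rewrite ractZ.
- exact: lact_ract.
- by rewrite lact_ract.
- by rewrite -(ract_scal (A:=A)) tpure_bal lact_scal.
Qed.

HB.instance Definition _ := GRing.Zmodule_isLmodule.Build K tensA
  (tscaleA tensA_compat) (tscale1 tensA_compat)
  (tscaleDr tensA_compat) (tscaleDl tensA_compat).
HB.instance Definition _ := isBimodule.Build K A tensA
  (tlactDl tensA_compat) (tlactDr tensA_compat) (tlactA tensA_compat)
  (fun u v a => tractDl tensA_compat a u v)
  (tractDr tensA_compat) (tractA tensA_compat) (tlact_ract tensA_compat)
  (tlact_scal tensA_compat) (tract_scal tensA_compat).

Lemma pureKDl m m' n : pureK (m + m') n = pureK m n + pureK m' n.
Proof. exact: tpureDl. Qed.
Lemma pureKDr m n n' : pureK m (n + n') = pureK m n + pureK m n'.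
Proof. exact: tpureDr. Qed.
Lemma pureKZl c m n : pureK (c *: m) n = c *: pureK m n.
Proof. by rewrite [RHS](scaleE tensK_compat). Qed.
Lemma pureKZr c m n : pureK m (c *: n) = c *: pureK m n.
Proof. by rewrite -pureKZl; apply/esym/(tpure_bal scaler). Qed.
Lemma pureKl a m n : pureK (a ▷ m) n = a ▷ pureK m n.
Proof. by rewrite [RHS](touter_lactE tensK_compat). Qed.
Lemma pureKr m n a : pureK m (n ◁ a) = pureK m n ◁ a.
Proof. by rewrite [RHS](touter_ractE tensK_compat). Qed.

Lemma pureADl m m' n : pureA (m + m') n = pureA m n + pureA m' n.
Proof. exact: tpureDl. Qed.
Lemma pureADr m n n' : pureA m (n + n') = pureA m n + pureA m n'.
Proof. exact: tpureDr. Qed.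
Lemma pureA_bal m a n : pureA (m ◁ a) n = pureA m (a ▷ n).
Proof. exact: tpure_bal. Qed.
Lemma pureAZl c m n : pureA (c *: m) n = c *: pureA m n.
Proof. by rewrite [RHS](scaleE tensA_compat). Qed.
Lemma pureAl a m n : pureA (a ▷ m) n = a ▷ pureA m n.
Proof. by rewrite [RHS](touter_lactE tensA_compat). Qed.
Lemma pureAr m n a : pureA m (n ◁ a) = pureA m n ◁ a.
Proof. by rewrite [RHS](touter_ractE tensA_compat). Qed.

End BimoduleTensors.

Notation "m ⊗ n" := (pureK m n) (at level 40, left associativity) : ring_scope.
Notation "m ⊗_A n" := (pureA m n) (at level 40, left associativity) : ring_scope.
Notation "M ⊗ N" := (tensK M%type N%type) (at level 40, left associativity) : type_scope.
Notation "M ⊗_A N" := (tensA M%type N%type) (at level 40, left associativity) : type_scope.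

Section QuantumPlane.
Context (K : comNzRingType) (q : K).

Inductive qterm : Type :=
| QX | QY | QScal of K | QAdd of qterm & qterm | QMul of qterm & qterm.

Inductive qcong : qterm -> qterm -> Prop :=
| qc_refl t : qcong t t
| qc_sym s t : qcong s t -> qcong t s
| qc_trans s t u : qcong s t -> qcong t u -> qcong s u
| qc_add s s' t t' : qcong s s' -> qcong t t' -> qcong (QAdd s t) (QAdd s' t')
| qc_mul s s' t t' : qcong s s' -> qcong t t' -> qcong (QMul s t) (QMul s' t')
| qc_addA s t u : qcong (QAdd s (QAdd t u)) (QAdd (QAdd s t) u)
| qc_addC s t : qcong (QAdd s t) (QAdd t s)
| qc_add0 t : qcong (QAdd (QScal 0) t) t
| qc_addN t : qcong (QAdd (QMul (QScal (-1)) t) t) (QScal 0)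
| qc_mulA s t u : qcong (QMul s (QMul t u)) (QMul (QMul s t) u)
| qc_mul1 t : qcong (QMul (QScal 1) t) t
| qc_mulDl s t u : qcong (QMul (QAdd s t) u) (QAdd (QMul s u) (QMul t u))
| qc_mulDr s t u : qcong (QMul s (QAdd t u)) (QAdd (QMul s t) (QMul s u))
| qc_scalD a b : qcong (QScal (a + b)) (QAdd (QScal a) (QScal b))
| qc_scalM a b : qcong (QScal (a * b)) (QMul (QScal a) (QScal b))
| qc_scalC a t : qcong (QMul (QScal a) t) (QMul t (QScal a))
| qc_xy : qcong (QMul QX QY) (QMul (QScal q) (QMul QY QX)).

HB.instance Definition _ := gen_eqMixin qterm.
HB.instance Definition _ := gen_choiceMixin qterm.

Definition qeq : rel qterm := fun s t => `[< qcong s t >].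

Lemma qeq_refl : reflexive qeq.
Proof. by move=> t; apply/asboolP; apply: qc_refl. Qed.
Lemma qeq_sym : symmetric qeq.
Proof. by move=> s t; apply/asboolP/asboolP; apply: qc_sym. Qed.
Lemma qeq_trans : transitive qeq.
Proof.
by move=> t s u /asboolP st /asboolP tu; apply/asboolP; apply: qc_trans tu.
Qed.
Canonical qeq_equiv := EquivRel qeq qeq_refl qeq_sym qeq_trans.

Definition qplane := {eq_quot qeq}.
HB.instance Definition _ := Choice.on qplane.
HB.instance Definition _ := EqQuotient.on qplane.

Lemma qplane_eqP s t : qcong s t <-> \pi_qplane s = \pi_qplane t.
Proof.
split=> [st|st]; first by apply/eqmodP/asboolP.
by move/eqmodP: st => /asboolP.
Qed.

Definition qpadd (u v : qplane) : qplane :=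
  \pi_qplane (QAdd (repr u) (repr v)).
Definition qpmul (u v : qplane) : qplane :=
  \pi_qplane (QMul (repr u) (repr v)).
Definition qpscal (c : K) : qplane := \pi_qplane (QScal c).
Definition qpopp (u : qplane) : qplane := qpmul (qpscal (-1)) u.
Definition qpscale (c : K) (u : qplane) : qplane := qpmul (qpscal c) u.

Lemma qpaddE s t : qpadd (\pi_qplane s) (\pi_qplane t) = \pi_qplane (QAdd s t).
Proof. by apply/qplane_eqP/qc_add; apply/qplane_eqP; rewrite reprK. Qed.
Lemma qpmulE s t : qpmul (\pi_qplane s) (\pi_qplane t) = \pi_qplane (QMul s t).
Proof. by apply/qplane_eqP/qc_mul; apply/qplane_eqP; rewrite reprK. Qed.

Lemma qpaddA : associative qpadd.
Proof.
elim/quotW=> s; elim/quotW=> t; elim/quotW=> u.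
by rewrite (qpaddE t u) (qpaddE s t) !qpaddE; apply/qplane_eqP/qc_addA.
Qed.
Lemma qpaddC : commutative qpadd.
Proof.
by elim/quotW=> s; elim/quotW=> t; rewrite !qpaddE; apply/qplane_eqP/qc_addC.
Qed.
Lemma qpadd0 : left_id (qpscal 0) qpadd.
Proof. by elim/quotW=> s; rewrite qpaddE; apply/qplane_eqP/qc_add0. Qed.
Lemma qpaddN : left_inverse (qpscal 0) qpopp qpadd.
Proof.
by elim/quotW=> s; rewrite /qpopp (qpmulE (QScal (-1)) s) qpaddE; apply/qplane_eqP/qc_addN.
Qed.

HB.instance Definition _ := GRing.isZmodule.Build qplane
  qpaddA qpaddC qpadd0 qpaddN.

Lemma qpmulA : associative qpmul.
Proof.
elim/quotW=> s; elim/quotW=> t; elim/quotW=> u.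
by rewrite (qpmulE t u) (qpmulE s t) !qpmulE; apply/qplane_eqP/qc_mulA.
Qed.
Lemma qpscalC c u : qpmul (qpscal c) u = qpmul u (qpscal c).
Proof. by elim/quotW: u => s; rewrite !qpmulE; apply/qplane_eqP/qc_scalC. Qed.
Lemma qpmul1l : left_id (qpscal 1) qpmul.
Proof. by elim/quotW=> s; rewrite qpmulE; apply/qplane_eqP/qc_mul1. Qed.
Lemma qpmul1r : right_id (qpscal 1) qpmul.
Proof. by move=> u; rewrite -qpscalC qpmul1l. Qed.
Lemma qpmulDl : left_distributive qpmul +%R.
Proof.
elim/quotW=> s; elim/quotW=> t; elim/quotW=> u.
rewrite -[_ + _ in LHS]/(qpadd (\pi s) (\pi t)) (qpaddE s t).
by rewrite (qpmulE s u) (qpmulE t u) qpmulE [RHS]qpaddE; apply/qplane_eqP/qc_mulDl.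
Qed.
Lemma qpmulDr : right_distributive qpmul +%R.
Proof.
elim/quotW=> s; elim/quotW=> t; elim/quotW=> u.
rewrite -[_ + _ in LHS]/(qpadd (\pi t) (\pi u)) (qpaddE t u).
by rewrite (qpmulE s t) (qpmulE s u) qpmulE [RHS]qpaddE; apply/qplane_eqP/qc_mulDr.
Qed.

(* the character x, y |-> 0 *)
Fixpoint qaugment (t : qterm) : K :=
  match t with
  | QX | QY => 0
  | QScal c => c
  | QAdd s t => qaugment s + qaugment t
  | QMul s t => qaugment s * qaugment t
  end.

Lemma qaugment_cong s t : qcong s t -> qaugment s = qaugment t.
Proof.
elim=> //=.
- by move=> ? ? ? _ -> _ ->.
- by move=> ? ? ? ? _ -> _ ->.
- by move=> ? ? ? ? _ -> _ ->.
- by move=> *; rewrite addrA.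
- by move=> *; rewrite addrC.
- by move=> *; rewrite add0r.
- by move=> *; rewrite mulN1r addNr.
- by move=> *; rewrite mulrA.
- by move=> *; rewrite mul1r.
- by move=> *; rewrite mulrDl.
- by move=> *; rewrite mulrDr.
- by move=> *; rewrite mulrC.
- by rewrite !mulr0.
Qed.

Lemma qpone_neq0 : qpscal 1 != 0.
Proof.
apply/eqP=> /qplane_eqP/qaugment_cong/eqP; apply/negP; exact: oner_neq0.
Qed.

HB.instance Definition _ := GRing.Zmodule_isNzRing.Build qplane
  qpmulA qpmul1l qpmul1r qpmulDl qpmulDr qpone_neq0.

Lemma qpscalM a b : qpscal (a * b) = qpscal a * qpscal b.
Proof. by rewrite [RHS]qpmulE; apply/qplane_eqP/qc_scalM. Qed.
Lemma qpscalD a b : qpscal (a + b) = qpscal a + qpscal b.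
Proof. by rewrite [RHS]qpaddE; apply/qplane_eqP/qc_scalD. Qed.

Lemma qpscaleA a b u : qpscale a (qpscale b u) = qpscale (a * b) u.
Proof. by rewrite /qpscale qpscalM [LHS]qpmulA. Qed.
Lemma qpscale1 : left_id 1 qpscale.
Proof. exact: qpmul1l. Qed.
Lemma qpscaleDr : right_distributive qpscale +%R.
Proof. by move=> c u v; apply: qpmulDr. Qed.
Lemma qpscaleDl u : {morph qpscale^~ u : a b / a + b}.
Proof. by move=> a b; rewrite /qpscale qpscalD [LHS]qpmulDl. Qed.

HB.instance Definition _ := GRing.Zmodule_isLmodule.Build K qplane
  qpscaleA qpscale1 qpscaleDr qpscaleDl.

Lemma qpscaleAl (c : K) (u v : qplane) : c *: (u * v) = (c *: u) * v.
Proof. exact: mulrA. Qed.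
HB.instance Definition _ := GRing.Lmodule_isLalgebra.Build K qplane qpscaleAl.
Lemma qpscaleAr (c : K) (u v : qplane) : c *: (u * v) = u * (c *: v).
Proof.
rewrite -[LHS]/(qpscal c * (u * v)) -[RHS]/(u * (qpscal c * v)).
by rewrite !mulrA; congr (_ * _); apply: qpscalC.
Qed.
HB.instance Definition _ := GRing.Lalgebra_isAlgebra.Build K qplane qpscaleAr.

Definition qx : qplane := \pi_qplane QX.
Definition qy : qplane := \pi_qplane QY.

Lemma qxyE : qx * qy = q *: (qy * qx).
Proof.
rewrite [LHS]qpmulE -[RHS]/(qpscal q * (qy * qx)).
by rewrite [qy * qx]qpmulE [RHS]qpmulE; apply/qplane_eqP/qc_xy.
Qed.

Lemma pi_qscal c : \pi_qplane (QScal c) = c%:A.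
Proof. by apply/esym; rewrite -[LHS]/(qpscal c * qpscal 1) -qpscalM mulr1. Qed.
Lemma pi_qadd s t : \pi_qplane (QAdd s t) = \pi_qplane s + \pi_qplane t.
Proof. by rewrite [RHS]qpaddE. Qed.
Lemma pi_qmul s t : \pi_qplane (QMul s t) = \pi_qplane s * \pi_qplane t.
Proof. by rewrite [RHS]qpmulE. Qed.

End QuantumPlane.

Section OneForms.
Context (K : comNzRingType) (q : K).
Local Notation A := (qplane q).
Local Notation x := (qx q).
Local Notation y := (qy q).

(* The A-bimodule generated by ξ = [FXi] and η = [FEta] subject to the last
   four relations of [fcong]; the other ones are the bimodule axioms. *)
Inductive fterm : Type :=
| FXi | FEta | FZero | FAdd of fterm & fterm
| FL of A & fterm | FR of fterm & A.

Inductive fcong : fterm -> fterm -> Prop :=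
| fc_refl t : fcong t t
| fc_sym s t : fcong s t -> fcong t s
| fc_trans s t u : fcong s t -> fcong t u -> fcong s u
| fc_add s s' t t' : fcong s s' -> fcong t t' -> fcong (FAdd s t) (FAdd s' t')
| fc_l a s s' : fcong s s' -> fcong (FL a s) (FL a s')
| fc_r a s s' : fcong s s' -> fcong (FR s a) (FR s' a)
| fc_addA s t u : fcong (FAdd s (FAdd t u)) (FAdd (FAdd s t) u)
| fc_addC s t : fcong (FAdd s t) (FAdd t s)
| fc_add0 t : fcong (FAdd FZero t) t
| fc_addN t : fcong (FAdd (FL (-1) t) t) FZero
| fc_lDl a b t : fcong (FL (a + b) t) (FAdd (FL a t) (FL b t))
| fc_lDr a s t : fcong (FL a (FAdd s t)) (FAdd (FL a s) (FL a t))
| fc_lA a b t : fcong (FL a (FL b t)) (FL (a * b) t)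
| fc_l1 t : fcong (FL 1 t) t
| fc_rDl s t a : fcong (FR (FAdd s t) a) (FAdd (FR s a) (FR t a))
| fc_rDr t a b : fcong (FR t (a + b)) (FAdd (FR t a) (FR t b))
| fc_rA t a b : fcong (FR (FR t a) b) (FR t (a * b))
| fc_lr a t b : fcong (FL a (FR t b)) (FR (FL a t) b)
| fc_scal (c : K) t : fcong (FL c%:A t) (FR t c%:A)
| fc_x_xi : fcong (FL x FXi) (FR FXi (q ^+ 2 *: x))
| fc_x_eta : fcong (FL x FEta)
    (FAdd (FR FEta (q *: x)) (FR FXi ((q ^+ 2 - 1) *: y)))
| fc_y_xi : fcong (FL y FXi) (FR FXi (q *: y))
| fc_y_eta : fcong (FL y FEta) (FR FEta (q ^+ 2 *: y)).

HB.instance Definition _ := gen_eqMixin fterm.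
HB.instance Definition _ := gen_choiceMixin fterm.

Definition feq : rel fterm := fun s t => `[< fcong s t >].

Lemma feq_refl : reflexive feq.
Proof. by move=> t; apply/asboolP; apply: fc_refl. Qed.
Lemma feq_sym : symmetric feq.
Proof. by move=> s t; apply/asboolP/asboolP; apply: fc_sym. Qed.
Lemma feq_trans : transitive feq.
Proof.
by move=> t s u /asboolP st /asboolP tu; apply/asboolP; apply: fc_trans tu.
Qed.
Canonical feq_equiv := EquivRel feq feq_refl feq_sym feq_trans.

Definition oneform := {eq_quot feq}.
HB.instance Definition _ := Choice.on oneform.
HB.instance Definition _ := EqQuotient.on oneform.

Lemma oneform_eqP s t : fcong s t <-> \pi_oneform s = \pi_oneform t.
Proof.
split=> [st|st]; first by apply/eqmodP/asboolP.
by move/eqmodP: st => /asboolP.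
Qed.

Definition fadd (u v : oneform) : oneform :=
  \pi_oneform (FAdd (repr u) (repr v)).
Definition flact (a : A) (u : oneform) : oneform := \pi_oneform (FL a (repr u)).
Definition fract (u : oneform) (a : A) : oneform := \pi_oneform (FR (repr u) a).
Definition fopp (u : oneform) : oneform := flact (-1) u.
Definition fscale (c : K) (u : oneform) : oneform := flact c%:A u.

Lemma faddE s t : fadd (\pi_oneform s) (\pi_oneform t) = \pi_oneform (FAdd s t).
Proof. by apply/oneform_eqP/fc_add; apply/oneform_eqP; rewrite reprK. Qed.
Lemma flactE a s : flact a (\pi_oneform s) = \pi_oneform (FL a s).
Proof. by apply/oneform_eqP/fc_l; apply/oneform_eqP; rewrite reprK. Qed.
Lemma fractE s a : fract (\pi_oneform s) a = \pi_oneform (FR s a).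
Proof. by apply/oneform_eqP/fc_r; apply/oneform_eqP; rewrite reprK. Qed.

Lemma faddA : associative fadd.
Proof.
elim/quotW=> s; elim/quotW=> t; elim/quotW=> u.
by rewrite (faddE t u) (faddE s t) !faddE; apply/oneform_eqP/fc_addA.
Qed.
Lemma faddC : commutative fadd.
Proof.
by elim/quotW=> s; elim/quotW=> t; rewrite !faddE; apply/oneform_eqP/fc_addC.
Qed.
Lemma fadd0 : left_id (\pi_oneform FZero) fadd.
Proof. by elim/quotW=> s; rewrite faddE; apply/oneform_eqP/fc_add0. Qed.
Lemma faddN : left_inverse (\pi_oneform FZero) fopp fadd.
Proof.
by elim/quotW=> s; rewrite /fopp (flactE (-1) s) faddE; apply/oneform_eqP/fc_addN.
Qed.

HB.instance Definition _ := GRing.isZmodule.Build oneform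
  faddA faddC fadd0 faddN.

Lemma flactDl a b u : flact (a + b) u = flact a u + flact b u.
Proof.
elim/quotW: u => s; rewrite (flactE a s) (flactE b s) flactE [RHS]faddE.
exact/oneform_eqP/fc_lDl.
Qed.
Lemma flactDr a (u v : oneform) : flact a (u + v) = flact a u + flact a v.
Proof.
elim/quotW: u => s; elim/quotW: v => t.
rewrite -[_ + _ in LHS]/(fadd (\pi s) (\pi t)) (faddE s t).
by rewrite (flactE a s) (flactE a t) flactE [RHS]faddE; apply/oneform_eqP/fc_lDr.
Qed.
Lemma flactA a b u : flact a (flact b u) = flact (a * b) u.
Proof.
by elim/quotW: u => s; rewrite (flactE b s) !flactE; apply/oneform_eqP/fc_lA.
Qed.
Lemma flact1 u : flact 1 u = u.
Proof. by elim/quotW: u => s; rewrite !flactE; apply/oneform_eqP/fc_l1. Qed.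
Lemma fractDl (u v : oneform) a : fract (u + v) a = fract u a + fract v a.
Proof.
elim/quotW: u => s; elim/quotW: v => t.
rewrite -[_ + _ in LHS]/(fadd (\pi s) (\pi t)) (faddE s t).
by rewrite (fractE s a) (fractE t a) fractE [RHS]faddE; apply/oneform_eqP/fc_rDl.
Qed.
Lemma fractDr u a b : fract u (a + b) = fract u a + fract u b.
Proof.
elim/quotW: u => s; rewrite (fractE s a) (fractE s b) fractE [RHS]faddE.
exact/oneform_eqP/fc_rDr.
Qed.
Lemma fractA u a b : fract (fract u a) b = fract u (a * b).
Proof.
by elim/quotW: u => s; rewrite (fractE s a) !fractE; apply/oneform_eqP/fc_rA.
Qed.
Lemma flact_ract a u b : flact a (fract u b) = fract (flact a u) b.
Proof.
elim/quotW: u => s; rewrite (fractE s b) (flactE a s) flactE fractE.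
exact/oneform_eqP/fc_lr.
Qed.

Lemma fscaleA c c' u : fscale c (fscale c' u) = fscale (c * c') u.
Proof. by rewrite /fscale flactA mulr_algl scalerA. Qed.
Lemma fscale1 : left_id 1 fscale.
Proof. by move=> u; rewrite /fscale scale1r flact1. Qed.
Lemma fscaleDr : right_distributive fscale +%R.
Proof. by move=> c u v; apply: flactDr. Qed.
Lemma fscaleDl u : {morph fscale^~ u : c c' / c + c'}.
Proof. by move=> c c'; rewrite /fscale scalerDl flactDl. Qed.
HB.instance Definition _ := GRing.Zmodule_isLmodule.Build K oneform
  fscaleA fscale1 fscaleDr fscaleDl.

Lemma flact_scal (c : K) (u : oneform) : flact c%:A u = c *: u.
Proof. by []. Qed.
Lemma fract_scal (u : oneform) (c : K) : fract u c%:A = c *: u.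
Proof.
apply/esym; rewrite -flact_scal.
by elim/quotW: u => s; rewrite flactE fractE; apply/oneform_eqP/fc_scal.
Qed.
HB.instance Definition _ := isBimodule.Build K A oneform
  flactDl flactDr flactA fractDl fractDr fractA flact_ract
  flact_scal fract_scal.

Definition xi : oneform := \pi_oneform FXi.
Definition eta : oneform := \pi_oneform FEta.

Lemma x_xiE : x ▷ xi = q ^+ 2 *: (xi ◁ x).
Proof.
rewrite ractZr [LHS]flactE [RHS]fractE; exact/oneform_eqP/fc_x_xi.
Qed.
Lemma x_etaE : x ▷ eta = q *: (eta ◁ x) + (q ^+ 2 - 1) *: (xi ◁ y).
Proof.
rewrite !ractZr [LHS]flactE [eta ◁ _]fractE [xi ◁ _]fractE [RHS]faddE.
exact/oneform_eqP/fc_x_eta.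
Qed.
Lemma y_xiE : y ▷ xi = q *: (xi ◁ y).
Proof.
rewrite ractZr [LHS]flactE [RHS]fractE; exact/oneform_eqP/fc_y_xi.
Qed.
Lemma y_etaE : y ▷ eta = q ^+ 2 *: (eta ◁ y).
Proof.
rewrite ractZr [LHS]flactE [RHS]fractE; exact/oneform_eqP/fc_y_eta.
Qed.

Fixpoint dterm (t : qterm K) : oneform :=
  match t with
  | QX => xi
  | QY => eta
  | QScal _ => 0
  | QAdd s t => dterm s + dterm t
  | QMul s t => dterm s ◁ \pi_A t + \pi_A s ▷ dterm t
  end.

Definition qd (a : A) : oneform := dterm (repr a).

Lemma dterm_cong s t : qcong q s t -> dterm s = dterm t.
Proof.
elim=> //=.
- by move=> ? ? ? _ -> _ ->.
- by move=> ? ? ? ? _ -> _ ->.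
- by move=> ? ? ? ? /qplane_eqP-> -> /qplane_eqP-> ->.
- by move=> *; rewrite addrA.
- by move=> *; rewrite addrC.
- by move=> *; rewrite add0r.
- by move=> *; rewrite ract0l add0r pi_qscal lact_scal scaleN1r addNr.
- by move=> *; rewrite !pi_qmul ractDl lactDr !ractA !lactA lact_ract addrA.
- by move=> *; rewrite ract0l add0r pi_qscal lact_scal scale1r.
- by move=> *; rewrite !pi_qadd ractDl lactDl addrACA.
- by move=> *; rewrite !pi_qadd ractDr lactDr addrACA.
- by rewrite addr0.
- by move=> *; rewrite ract0l lact0r addr0.
- by move=> *; rewrite ract0l lact0r add0r addr0 !pi_qscal lact_scal ract_scal.
- rewrite ract0l add0r pi_qscal lact_scal -/x -/y x_etaE y_xiE.
  rewrite !scalerDr !scalerA -expr2 [_ *: _ + _ *: _ in LHS]addrC addrA.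
  by rewrite -{1}(scale1r (xi ◁ y)) -scalerDl addrC subrKC.
Qed.

Lemma qd_pi t : qd (\pi_A t) = dterm t.
Proof. by apply: dterm_cong; apply/qplane_eqP; rewrite reprK. Qed.

Lemma qd_x : qd x = xi.
Proof. exact: qd_pi. Qed.
Lemma qd_y : qd y = eta.
Proof. exact: qd_pi. Qed.
Lemma qdM a b : qd (a * b) = qd a ◁ b + a ▷ qd b.
Proof.
by elim/quotW: a => s; elim/quotW: b => t; rewrite -pi_qmul !qd_pi.
Qed.
Lemma qd_linear : linear qd.
Proof.
move=> c a b; elim/quotW: a => s; elim/quotW: b => t.
rewrite -mulr_algl -pi_qscal -pi_qmul -pi_qadd !qd_pi /=.
by rewrite ract0l add0r pi_qscal lact_scal.
Qed.
HB.instance Definition _ := GRing.isLinear.Build K A oneform *:%R qd qd_linear.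

End OneForms.

Notation "'ξ'" := (xi _) : ring_scope.
Notation "'η'" := (eta _) : ring_scope.

Section Metrics.
Context (K : comNzRingType) (q : K).
Local Notation A := (qplane q).
Local Notation A1 := (oneform q).

(* The bimodule A1 ⊗ A1 is free on ξ⊗ξ, ξ⊗η, η⊗ξ, η⊗η for the outer actions,
   so that there is exactly one such τ when q is a unit. *)
Record is_braiding (tau : A1 ⊗ A1 -> A1 ⊗ A1) : Prop := {
  braiding_linear : linear tau;
  braiding_lact : forall (a : A) u, tau (a ▷ u) = a ▷ tau u;
  braiding_ract : forall u (a : A), tau (u ◁ a) = tau u ◁ a;
  braiding_bij : bijective tau;
  braiding_xi_xi : tau (ξ ⊗ ξ) = ξ ⊗ ξ;
  braiding_xi_eta : tau (ξ ⊗ η) = q *: (η ⊗ ξ);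
  braiding_eta_xi : tau (η ⊗ ξ) = q *: (ξ ⊗ η) - (q ^+ 2 - 1) *: (η ⊗ ξ);
  braiding_eta_eta : tau (η ⊗ η) = η ⊗ η }.

Record symmetric_metric (tau : A1 ⊗ A1 -> A1 ⊗ A1) (g : A1 ⊗ A1 -> A) : Prop := {
  metric_linear : linear g;
  metric_bilinear : forall (a b : A) (ζ ρ : A1),
    g ((a ▷ ζ) ⊗ (ρ ◁ b)) = a * g (ζ ⊗ ρ) * b;
  metric_symmetric : forall u, g (tau u) = g u }.

Record left_connection (nabla : A1 -> A1 ⊗_A A1) : Prop := {
  left_connection_linear : linear nabla;
  left_connection_leibniz : forall (a : A) (ζ : A1),
    nabla (a ▷ ζ) = qd a ⊗_A ζ + a ▷ nabla ζ }.

Record right_connection (nabla : A1 -> A1 ⊗_A A1) : Prop := {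
  right_connection_linear : linear nabla;
  right_connection_leibniz : forall (ζ : A1) (a : A),
    nabla (ζ ◁ a) = nabla ζ ◁ a + ζ ⊗_A qd a }.

(* Additive, with the expected values on pure tensors, as soon as g is a metric:
   see [gcheckD], [gcheckE], [ghatD] and [ghatE]. *)
Definition gcheck (g : A1 ⊗ A1 -> A) : (A1 ⊗_A A1) ⊗ A1 -> A1 :=
  tlift (fun u ρ => tlift (fun α ζ => α ◁ g (ζ ⊗ ρ)) u).

Definition ghat (g : A1 ⊗ A1 -> A) : A1 ⊗ (A1 ⊗_A A1) -> A1 :=
  tlift (fun ζ u => tlift (fun ρ α => g (ζ ⊗ ρ) ▷ α) u).

Section Extensions.
Context (tau : A1 ⊗ A1 -> A1 ⊗ A1) (g : A1 ⊗ A1 -> A).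
Hypothesis gP : symmetric_metric tau g.

Lemma metricD u v : g (u + v) = g u + g v.
Proof. by have := metric_linear gP 1 u v; rewrite !scale1r. Qed.
Lemma metricZ c u : g (c *: u) = c *: g u.
Proof.
have g0 : g 0 = 0 by apply: (@addIr _ (g 0)); rewrite -metricD !add0r.
by have := metric_linear gP c u 0; rewrite g0 !addr0.
Qed.

Lemma gcheck_bal ρ :
  balanced (@ract K A A1) (@lact K A A1) (fun α ζ => α ◁ g (ζ ⊗ ρ)).
Proof.
split=> [m m' n|m n n'|m s n]; first by rewrite ractDl.
- by rewrite pureKDl metricD ractDr.
- by rewrite ractA -{2}(ract1 ρ) (metric_bilinear gP) mulr1.
Qed.

Lemma ghat_bal ζ :
  balanced (@ract K A A1) (@lact K A A1) (fun ρ α => g (ζ ⊗ ρ) ▷ α).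
Proof.
split=> [m m' n|m n n'|m s n].
- by rewrite pureKDr metricD lactDl.
- by rewrite lactDr.
- by rewrite lactA -{1}(lact1 ζ) (metric_bilinear gP) mul1r.
Qed.

Lemma gcheck_outer_bal : balanced (@scaler K A (A1 ⊗_A A1)%type) (@GRing.scale K A1)
  (fun u ρ => tlift (fun α ζ => α ◁ g (ζ ⊗ ρ)) u).
Proof.
split=> [u v ρ|u ρ ρ'|u c ρ]; first exact: tliftD (gcheck_bal ρ) u v.
- move: u; apply: additive_eq => [u v|u v|α ζ].
  + exact: (tliftD (gcheck_bal _)).
  + by rewrite !(tliftD (gcheck_bal _)) addrACA.
  + by rewrite !(tliftE (gcheck_bal _)) pureKDr metricD ractDr.
- rewrite /scaler; move: u; apply: additive_eq => [u v|u v|α ζ].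
  + by rewrite scalerDr (tliftD (gcheck_bal _)).
  + exact: (tliftD (gcheck_bal _)).
  + rewrite -[tpure _ _ α ζ]/(pureA α ζ) -pureAZl !(tliftE (gcheck_bal _)).
    by rewrite pureKZr metricZ -ractZr ractZ.
Qed.

Lemma ghat_outer_bal : balanced (@scaler K A A1) (@GRing.scale K (A1 ⊗_A A1)%type)
  (fun ζ u => tlift (fun ρ α => g (ζ ⊗ ρ) ▷ α) u).
Proof.
split=> [ζ ζ' u|ζ u v|ζ c u]; last 2 first.
- exact: tliftD (ghat_bal ζ) u v.
- rewrite /scaler; move: u; apply: additive_eq => [u v|u v|ρ α].
  + exact: (tliftD (ghat_bal _)).
  + by rewrite scalerDr (tliftD (ghat_bal _)).
  + rewrite -[tpure _ _ ρ α]/(pureA ρ α) -pureAZl !(tliftE (ghat_bal _)).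
    by rewrite pureKZl pureKZr.
move: u; apply: additive_eq => [u v|u v|ρ α].
- exact: (tliftD (ghat_bal _)).
- by rewrite !(tliftD (ghat_bal _)) addrACA.
- by rewrite !(tliftE (ghat_bal _)) pureKDl metricD lactDl.
Qed.

Lemma gcheckD : {morph gcheck g : u v / u + v}.
Proof. exact: tliftD gcheck_outer_bal. Qed.
Lemma gcheckE α ζ ρ : gcheck g ((α ⊗_A ζ) ⊗ ρ) = α ◁ g (ζ ⊗ ρ).
Proof. by rewrite [LHS](tliftE gcheck_outer_bal) (tliftE (gcheck_bal ρ)). Qed.

Lemma ghatD : {morph ghat g : u v / u + v}.
Proof. exact: tliftD ghat_outer_bal. Qed.
Lemma ghatE ζ ρ α : ghat g (ζ ⊗ (ρ ⊗_A α)) = g (ζ ⊗ ρ) ▷ α.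
Proof. by rewrite [LHS](tliftE ghat_outer_bal) (tliftE (ghat_bal ζ)). Qed.

End Extensions.

Definition metric_compat_at (g : A1 ⊗ A1 -> A) (nablaL nablaR : A1 -> A1 ⊗_A A1)
    (ζ ρ : A1) : Prop :=
  qd (g (ζ ⊗ ρ)) = gcheck g (nablaL ζ ⊗ ρ) + ghat g (ζ ⊗ nablaR ρ).

End Metrics.

(* Main.v *)
(* The defect D(ζ,ρ) of the compatibility condition satisfies
   D(aζ, ρb) = a D(ζ,ρ) b, because the da- and db-terms of the two Leibniz rules
   cancel. As q^2 + q + 1 = 0, the element z = y^3 x^3 of A is central in A and
   acts centrally on A^1, and z A^1 is contained in the A-span of the two central
   one-forms ξxy and ηy^2x^2 - ξy^3x. Hence compatibility on the centre gives
   z D(ζ,ρ) z = D(zζ, ρz) = 0, and A^1 has no z-torsion. *)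
From HB Require Import structures.
Require Import Defs.
From mathcomp Require Import all_boot all_order all_algebra generic_quotient.
From mathcomp Require Import ring lra.
From mathcomp Require Import complex reals sequences exp trigo.

Set Implicit Arguments.
Unset Strict Implicit.
Unset Printing Implicit Defensive.

Import GRing.Theory Num.Theory Order.TTheory.
Local Open Scope ring_scope.
Local Open Scope quotient_scope.

(** * Induction principles for A and A^1 *)

Section QuantumPlaneInduction.
Context (K : comNzRingType) (q : K).

Lemma qplane_ind (P : qplane q -> Prop) :
  P (qx q) -> P (qy q) -> (forall c : K, P c%:A) ->
  (forall a b, P a -> P b -> P (a + b)) ->
  (forall a b, P a -> P b -> P (a * b)) -> forall a, P a.
Proof.
move=> Px Py Pc PD PM; elim/quotW; elim=> [||c|s Ps t Pt|s Ps t Pt] //.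
- by rewrite pi_qscal; apply: Pc.
- by rewrite pi_qadd; apply: PD.
- by rewrite pi_qmul; apply: PM.
Qed.

Lemma oneform_ind (P : oneform q -> Prop) :
  P (xi q) -> P (eta q) -> P 0 ->
  (forall u v, P u -> P v -> P (u + v)) ->
  (forall a u, P u -> P (a ▷ u)) -> (forall u a, P u -> P (u ◁ a)) ->
  forall u, P u.
Proof.
move=> Px Pe P0 PD PL PR; elim/quotW; elim=> [|||s Ps t Pt|a s Ps|s Ps a] //.
- by rewrite -faddE; apply: PD.
- by rewrite -flactE; apply: PL.
- by rewrite -fractE; apply: PR.
Qed.

End QuantumPlaneInduction.

(* Left multiplication of A on itself, written on K[Y][X] in the basis y^i x^j,
   shows that x and y are left regular. *)
Section NormalForm.
Context (K : fieldType) (q : K).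
Hypothesis q0 : q != 0.
Local Notation A := (qplane q).
Local Notation x := (qx q).
Local Notation y := (qy q).
Local Notation P := {poly {poly K}}.

(** The substitution Y -> qY in the coefficients: moving x past y^i costs a factor q^i. *)
Definition qdilate : P -> P := map_poly (comp_poly (q *: 'X)).

Fixpoint qterm_act (t : qterm K) (p : P) : P :=
  match t with
  | QX => 'X * qdilate p
  | QY => 'X *: p
  | QScal c => c%:P *: p
  | QAdd s t => qterm_act s p + qterm_act t p
  | QMul s t => qterm_act s (qterm_act t p)
  end.

Lemma qterm_actD t : {morph qterm_act t : p p' / p + p'}.
Proof.
elim: t => [||c|s Hs t Ht|s Hs t Ht] p p' /=; rewrite ?scalerDr //.
- by rewrite /qdilate rmorphD mulrDr.
- by rewrite Hs Ht addrACA.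
- by rewrite Ht Hs.
Qed.

Lemma qterm_actZ t (c : K) p : qterm_act t (c%:P *: p) = c%:P *: qterm_act t p.
Proof.
elim: t p => [||e|s Hs t Ht|s Hs t Ht] p /=.
- by rewrite /qdilate map_polyZ /= comp_polyC scalerAr.
- by rewrite !scalerA mulrC.
- by rewrite !scalerA mulrC.
- by rewrite Hs Ht scalerDr.
- by rewrite Ht Hs.
Qed.

(** This makes the action descend to A. The relation xy = qyx holds because [qdilate] multiplies the
    coefficient variable by q; right distributivity and commutation with scalars are the additivity
    and linearity of the action. *)
Lemma qterm_act_cong s t : qcong q s t -> qterm_act s =1 qterm_act t.
Proof.
elim=> //=.
- by move=> ? ? _ H p; rewrite H.
- by move=> ? ? ? _ H _ H' p; rewrite H H'.
- by move=> ? ? ? ? _ H _ H' p; rewrite H H'.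
- by move=> ? ? ? ? _ H _ H' p; rewrite H' H.
- by move=> ? ? ? p; rewrite addrA.
- by move=> ? ? p; rewrite addrC.
- by move=> ? p; rewrite polyC0 scale0r add0r.
- by move=> ? p; rewrite polyCN polyC1 scaleN1r addNr polyC0 scale0r.
- by move=> ? p; rewrite polyC1 scale1r.
- by move=> ? ? ? p; rewrite qterm_actD.
- by move=> a b p; rewrite polyCD scalerDl.
- by move=> a b p; rewrite polyCM scalerA.
- by move=> ? ? p; rewrite qterm_actZ.
- move=> p; rewrite /qdilate map_polyZ /= comp_polyX -scalerAr scalerA.
  by rewrite mul_polyC.
Qed.

Definition qnormal_inner : {poly K} -> A := horner_alg y.
HB.instance Definition _ := GRing.RMorphism.on qnormal_inner.
Definition qnormal (p : P) : A := (map_poly qnormal_inner p).[x].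

Lemma qnormalD : {morph qnormal : p p' / p + p'}.
Proof. by move=> p p'; rewrite /qnormal rmorphD hornerD. Qed.

Lemma qnormalZ c p : qnormal (c *: p) = qnormal_inner c * qnormal p.
Proof. by rewrite /qnormal map_polyZ hornerZ. Qed.

Lemma qnormalMX p : qnormal ('X * p) = qnormal p * x.
Proof. by rewrite mulrC /qnormal rmorphM /= map_polyX hornerMX. Qed.

Lemma qx_mul_inner c :
  x * qnormal_inner c = qnormal_inner (c \Po (q *: 'X)) * x.
Proof.
elim/poly_ind: c => [|p c IH]; first by rewrite comp_poly0 !rmorph0 mulr0 mul0r.
rewrite comp_polyD comp_polyM comp_polyX comp_polyC !rmorphD !rmorphM /=.
rewrite mulrDr mulrDl mulrA IH -!mulrA; congr (_ + _).
  congr (_ * _); rewrite -mul_polyC rmorphM /= /qnormal_inner horner_algC horner_algX.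
  by rewrite qxyE mulr_algl scalerAl.
by rewrite /qnormal_inner horner_algC mulr_algl mulr_algr.
Qed.

Lemma qnormal_x p : qnormal ('X * qdilate p) = x * qnormal p.
Proof.
rewrite qnormalMX; elim/poly_ind: p => [|p c IH].
  by rewrite /qdilate rmorph0 /qnormal rmorph0 horner0 mulr0 mul0r.
rewrite /qdilate rmorphD rmorphM /= map_polyX map_polyC /= !qnormalD.
rewrite ![_ * 'X]mulrC !qnormalMX mulrDl mulrDr -[map_poly _ p]/(qdilate p).
rewrite IH mulrA; congr (_ + _).
by rewrite -!alg_polyC !qnormalZ /qnormal rmorph1 hornerC !mulr1 qx_mul_inner.
Qed.

(** [qnormal] sends the sum of c_j(Y) X^j to the sum of c_j(y) x^j and intertwines the action with
    left multiplication. At p = 1 this makes [qnormal] a left inverse of [qcoord], so an element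
    with zero coordinates is zero. *)
Lemma qnormal_act t p : qnormal (qterm_act t p) = \pi_(qplane q) t * qnormal p.
Proof.
elim: t p => [||c|s Hs t Ht|s Hs t Ht] p /=.
- exact: qnormal_x.
- by rewrite qnormalZ /qnormal_inner horner_algX.
- by rewrite qnormalZ /qnormal_inner horner_algC pi_qscal.
- by rewrite qnormalD Hs Ht pi_qadd mulrDl.
- by rewrite Hs Ht pi_qmul mulrA.
Qed.

Definition qcoord (a : A) : P := qterm_act (repr a) 1.

Lemma qcoordK : cancel qcoord qnormal.
Proof.
by move=> a; rewrite /qcoord qnormal_act reprK /qnormal rmorph1 hornerC mulr1.
Qed.

Lemma qcoordM t a : qcoord (\pi_(qplane q) t * a) = qterm_act t (qcoord a).
Proof.
elim/quotW: a => s; rewrite -pi_qmul /qcoord.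
have E u : qterm_act (repr (\pi_(qplane q) u)) =1 qterm_act u.
  by apply: qterm_act_cong; apply/qplane_eqP; rewrite reprK.
by rewrite !E.
Qed.

Lemma qcoord0 : qcoord 0 = 0.
(* The zero of A is by construction the class of [QScal 0], which acts as 0. *)
Proof. by rewrite -[0 in LHS](mul0r (0 : A)) [LHS]qcoordM /= polyC0 scale0r. Qed.

Lemma qcoord_eq0 a : qcoord a = 0 -> a = 0.
Proof. by move=> a0; rewrite -(qcoordK a) a0 /qnormal rmorph0 horner0. Qed.

Lemma qy_reg a : y * a = 0 -> a = 0.
Proof.
move=> /(congr1 qcoord); rewrite qcoordM qcoord0 /= => /eqP.
by rewrite -mul_polyC mulf_eq0 polyC_eq0 polyX_eq0 /= => /eqP/qcoord_eq0.
Qed.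

Lemma qx_reg a : x * a = 0 -> a = 0.
Proof.
move=> /(congr1 qcoord); rewrite qcoordM qcoord0 /= => /eqP.
rewrite mulf_eq0 polyX_eq0 /= => /eqP a0; apply: qcoord_eq0.
(* Dilation is injective: for q nonzero, qX has size 2, and composing with it kills only 0. *)
apply: (@map_inj_poly _ _ (comp_poly (q *: 'X))); rewrite ?rmorph0 //.
apply: raddf_inj => c /eqP; rewrite comp_poly2_eq0 ?size_scale ?size_polyX //.
by move/eqP.
Qed.

End NormalForm.

(** * Signs in bimodules *)

Section BimoduleOpposite.
Context (K : comNzRingType) (A : algType K) (M : bimodType A).

Lemma lactN (a : A) (m : M) : a ▷ (- m) = - (a ▷ m).
Proof. by rewrite -scaleN1r -lactZ scaleN1r. Qed.

Lemma ractN (m : M) (a : A) : (- m) ◁ a = - (m ◁ a).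
Proof. by rewrite -scaleN1r -ractZ scaleN1r. Qed.

End BimoduleOpposite.

(** * Bimodule maps from A^1 to A *)

Section OneformMaps.
Context (K : comNzRingType) (q : K).
Local Notation A := (qplane q).
Local Notation x := (qx q).
Local Notation y := (qy q).
Context (al be : A).
Hypothesis x_al : x * al = q ^+ 2 *: (al * x).
Hypothesis x_be : x * be = q *: (be * x) + (q ^+ 2 - 1) *: (al * y).
Hypothesis y_al : y * al = q *: (al * y).
Hypothesis y_be : y * be = q ^+ 2 *: (be * y).

Fixpoint fterm_eval (t : fterm q) : A :=
  match t with
  | FXi => al
  | FEta => be
  | FZero => 0
  | FAdd s t => fterm_eval s + fterm_eval t
  | FL a t => a * fterm_eval t
  | FR t a => fterm_eval t * a
  end.

(** The hypotheses on [al] and [be] are the images of the four defining relations of A^1, so ξ ->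
    [al], η -> [be] extends to a bimodule map. *)
Lemma fterm_eval_cong s t : fcong s t -> fterm_eval s = fterm_eval t.
Proof.
elim=> //=.
- by move=> ? ? ? _ -> _ ->.
- by move=> ? ? ? ? _ -> _ ->.
- by move=> ? ? ? _ ->.
- by move=> ? ? ? _ ->.
- by move=> *; rewrite addrA.
- by move=> *; rewrite addrC.
- by move=> *; rewrite add0r.
- by move=> *; rewrite mulN1r addNr.
- by move=> *; rewrite mulrDl.
- by move=> *; rewrite mulrDr.
- by move=> *; rewrite mulrA.
- by move=> *; rewrite mul1r.
- by move=> *; rewrite mulrDl.
- by move=> *; rewrite mulrDr.
- by move=> *; rewrite mulrA.
- by move=> *; rewrite mulrA.
- by move=> *; rewrite mulr_algl mulr_algr.
- by rewrite x_al -scalerAr.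
- by rewrite x_be -!scalerAr.
- by rewrite y_al -scalerAr.
- by rewrite y_be -scalerAr.
Qed.

Definition oneform_map (u : oneform q) : A := fterm_eval (repr u).

Lemma oneform_map_pi t : oneform_map (\pi_(oneform q) t) = fterm_eval t.
Proof. by apply: fterm_eval_cong; apply/oneform_eqP; rewrite reprK. Qed.

Lemma oneform_mapD : {morph oneform_map : u v / u + v}.
Proof.
by elim/quotW=> s; elim/quotW=> t; rewrite [_ + _ in LHS]faddE !oneform_map_pi.
Qed.

Lemma oneform_map0 : oneform_map (0 : oneform q) = 0.
Proof. exact: oneform_map_pi. Qed.

Lemma oneform_mapL a u : oneform_map (a ▷ u) = a * oneform_map u.
Proof. by elim/quotW: u => s; rewrite [a ▷ _]flactE !oneform_map_pi. Qed.

Lemma oneform_map_xi : oneform_map (xi q) = al.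
Proof. exact: oneform_map_pi. Qed.

Lemma oneform_map_eta : oneform_map (eta q) = be.
Proof. exact: oneform_map_pi. Qed.

End OneformMaps.

(** * The central element y^3 x^3 for q^2 + q + 1 = 0 *)

Section ThirdRoot.
Context (K : fieldType) (q : K).
Hypothesis hq : q ^+ 2 + q + 1 = 0.
Local Notation A := (qplane q).
Local Notation A1 := (oneform q).
Local Notation x := (qx q).
Local Notation y := (qy q).

Lemma q3 : q ^+ 3 = 1.
Proof.
apply/eqP; rewrite -subr_eq0 (_ : _ - 1 = (q - 1) * (q ^+ 2 + q + 1)); last by ring.
by rewrite hq mulr0.
Qed.

Lemma qqq1 : q * q * q = 1.
Proof. by rewrite -q3; ring. Qed.

Lemma q_neq0 : q != 0.
Proof. by apply/eqP=> q0; have/eqP := q3; rewrite q0 expr0n eq_sym oner_eq0. Qed.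

(** Here k is an explicit cofactor, so that each use leaves a polynomial identity for [ring]. *)
Lemma eq_modq (k a b : K) : a - b = k * (q ^+ 2 + q + 1) -> a = b.
Proof. by rewrite hq mulr0 => /eqP; rewrite subr_eq0 => /eqP. Qed.

Lemma qxyAE (a : A) : x * (y * a) = q *: (y * (x * a)).
Proof. by rewrite mulrA qxyE -scalerAl -mulrA. Qed.

(* Rewrites a right-nested word as a multiple of some y^i x^j. *)
Definition qplane_sort := (qxyAE, qxyE, =^~ scalerAr, =^~ scalerAl, scalerA).

Definition qcube : A := y * (y * (y * (x * (x * x)))).

(** Moving x past y^3, or y past x^3, costs q^3 = 1. *)
Lemma qcube_central (a : A) : qcube * a = a * qcube.
Proof.
elim/qplane_ind: a => [||c|a b Ha Hb|a b Ha Hb].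
- by rewrite /qcube -!mulrA !qplane_sort qqq1 scale1r.
- by rewrite /qcube -!mulrA !qplane_sort qqq1 scale1r.
- by rewrite mulr_algl mulr_algr.
- by rewrite mulrDl mulrDr Ha Hb.
- by rewrite mulrA Ha -mulrA Hb mulrA.
Qed.

Lemma qcube_reg (a : A) : qcube * a = 0 -> a = 0.
Proof. by rewrite /qcube -!mulrA; do 3!move/qy_reg; do 3!move/(qx_reg q_neq0). Qed.

(** * Generation of A^1 by ξ and η as a left module *)

Lemma xi_x : ξ ◁ x = (q *: x) ▷ (ξ : A1).
Proof.
rewrite -lactZl x_xiE scalerA (_ : q * q ^+ 2 = 1) ?scale1r //.
by rewrite -q3; ring.
Qed.

Lemma xi_y : ξ ◁ y = (q ^+ 2 *: y) ▷ (ξ : A1).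
Proof.
rewrite -lactZl y_xiE scalerA (_ : q ^+ 2 * q = 1) ?scale1r //.
by rewrite -q3; ring.
Qed.

Lemma eta_y : η ◁ y = (q *: y) ▷ (η : A1).
Proof.
rewrite -lactZl y_etaE scalerA (_ : q * q ^+ 2 = 1) ?scale1r //.
by rewrite -q3; ring.
Qed.

Lemma eta_x :
  η ◁ x = ((q - 1) *: y) ▷ (ξ : A1) + (q ^+ 2 *: x) ▷ η.
Proof.
(* The total coefficient of ξy after all left actions are moved to the right. *)
have c0 : (q - 1) * q + q ^+ 2 * (q ^+ 2 - 1) = 0.
  by apply: (@eq_modq (q * (q - 1))); ring.
rewrite -!lactZl x_etaE y_xiE scalerDr !scalerA addrCA -scalerDl c0 scale0r addr0.
by rewrite -exprSr q3 scale1r.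
Qed.

Definition lspan (u : A1) : Prop := exists a b : A, u = a ▷ ξ + b ▷ η.

Lemma lspanD u v : lspan u -> lspan v -> lspan (u + v).
Proof.
move=> [a [b ->]] [a' [b' ->]]; exists (a + a'), (b + b').
by rewrite !lactDl addrACA.
Qed.

Lemma lspanL a u : lspan u -> lspan (a ▷ u).
Proof.
by move=> [b [c ->]]; exists (a * b), (a * c); rewrite lactDr !lactA.
Qed.

Lemma lspanR u a : lspan u -> lspan (u ◁ a).
Proof.
have lspan_gen (b c : A) : lspan (b ▷ ξ + c ▷ η) by exists b, c.
(* Left coefficients can be pulled out. Both generators are treated at once because ηx has a
   ξ-component. *)
suff H : lspan (ξ ◁ a) /\ lspan (η ◁ a).
  move=> [b [c ->]]; rewrite ractDl -!lact_ract.
  by apply: lspanD; apply: lspanL; case: H.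
elim/qplane_ind: a => [||c|a b [Ha Ha'] [Hb Hb']|a b Ha [Hb Hb']].
- rewrite xi_x eta_x; split=> //.
  by rewrite -[_ ▷ _]addr0 -[X in _ + X](lact0l (M := A1) η).
- rewrite xi_y eta_y; split.
    by rewrite -[_ ▷ _]addr0 -[X in _ + X](lact0l (M := A1) η).
  by rewrite -[_ ▷ _]add0r -[X in X + _](lact0l (M := A1) ξ).
- rewrite !ract_scal -!(lact_scal (A := A)); split.
    by rewrite -[_ ▷ _]addr0 -[X in _ + X](lact0l (M := A1) η).
  by rewrite -[_ ▷ _]add0r -[X in X + _](lact0l (M := A1) ξ).
- by rewrite !ractDr; split; apply: lspanD.
- rewrite -!ractA; case: Ha => [[c [d ->]] [c' [d' ->]]].
  by split; rewrite ractDl -!lact_ract; apply: lspanD; apply: lspanL.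
Qed.

Lemma oneform_lspan u : lspan u.
Proof.
elim/oneform_ind: u => [|||u v Hu Hv|a u Hu|u a Hu].
- by exists 1, 0; rewrite lact1 lact0l addr0.
- by exists 0, 1; rewrite lact1 lact0l add0r.
- by exists 0, 0; rewrite !lact0l addr0.
- exact: lspanD.
- exact: lspanL.
- exact: lspanR.
Qed.

(** * Central one-forms *)

Definition xi_central : A1 := ξ ◁ (x * y).
(** The ξ-term is a correction: carrying x past η y^2x^2 leaves an extra (q^2 - 1) ξ y^3x^2, while
    -ξ y^3x yields -q^2 ξ y^3x^2. The sum is -ξ y^3x^2, as on the right-hand side. *)
Definition eta_central : A1 := η ◁ (y * (y * (x * x))) - ξ ◁ (y * (y * (y * x))).

Lemma central_gen (u : A1) :
  x ▷ u = u ◁ x -> y ▷ u = u ◁ y -> bimod_center u.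
Proof.
move=> ux uy; elim/qplane_ind=> [||c|a b Ha Hb|a b Ha Hb] //.
- by rewrite lact_scal ract_scal.
- by rewrite lactDl ractDr Ha Hb.
- by rewrite -lactA -ractA Hb -Ha lact_ract.
Qed.

Lemma x_xi (a : A) : x ▷ ((ξ : A1) ◁ a) = q ^+ 2 *: (ξ ◁ (x * a)).
Proof. by rewrite lact_ract x_xiE -ractZ ractA. Qed.

Lemma x_eta (a : A) : x ▷ ((η : A1) ◁ a) =
  q *: (η ◁ (x * a)) + (q ^+ 2 - 1) *: (ξ ◁ (y * a)).
Proof. by rewrite lact_ract x_etaE ractDl -!ractZ !ractA. Qed.

Lemma y_xi (a : A) : y ▷ ((ξ : A1) ◁ a) = q *: (ξ ◁ (y * a)).
Proof. by rewrite lact_ract y_xiE -ractZ ractA. Qed.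

Lemma y_eta (a : A) : y ▷ ((η : A1) ◁ a) = q ^+ 2 *: (η ◁ (y * a)).
Proof. by rewrite lact_ract y_etaE -ractZ ractA. Qed.

Lemma xi_centralP : bimod_center xi_central.
Proof.
apply: central_gen; rewrite /xi_central ?x_xi ?y_xi ractA -!mulrA !qplane_sort;
  rewrite -!ractZr ?scalerA //; congr (_ *: _).
by apply: (@eq_modq (q * (q - 1))); ring.
Qed.

Lemma eta_centralP : bimod_center eta_central.
Proof.
rewrite /eta_central; apply: central_gen.
  rewrite lactDr lactN ractDl ractN !ractA x_eta x_xi.
  rewrite -!mulrA !qplane_sort -!ractZr !scalerA.
  rewrite [q * q * q]qqq1 (mulrA q) qqq1 mulr1 scale1r -addrA -scalerBl.
  by rewrite addrAC addrN add0r scaleN1r.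
rewrite lactDr lactN ractDl ractN !ractA y_eta y_xi -!mulrA !qplane_sort -!ractZr.
by [].
Qed.

Lemma xi_qcube : ξ ◁ qcube = xi_central ◁ (y * (y * (x * x))).
Proof. by rewrite /xi_central /qcube ractA -!mulrA !qplane_sort qqq1 scale1r. Qed.

(** The η-part of the first product is already η y^3x^3; the second product cancels the ξ-part, a
    multiple of ξ y^4x^2. *)
Lemma eta_qcube : η ◁ qcube =
  eta_central ◁ (q *: (y * x)) + xi_central ◁ (q *: (y * (y * (y * x)))).
Proof.
rewrite /eta_central /xi_central /qcube ractDl ractN -!ractZr !ractA -!mulrA !qplane_sort.
rewrite -!ractZr !scalerA (mulrA q) qqq1 scale1r.
by rewrite mul1r subrK.
Qed.

Definition oneform_push := (x_xi, x_eta, y_xi, y_eta, @lactDr, =^~ lactZ).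

Lemma qcube_oneform (u : A1) : qcube ▷ u = u ◁ qcube.
Proof.
have [a [b ->]] := oneform_lspan u.
(* Three x and three y pass ξ with factor (q^2)^3 q^3, and pass η with diagonal factor q^3 (q^2)^3;
   both are q^9. *)
have q9 : q ^+ 9 = 1 by rewrite (exprM q 3 3) q3 expr1n.
have qcube_xi : qcube ▷ ξ = ξ ◁ qcube :> A1.
  rewrite -[ξ in LHS](ract1 (A := A)) /qcube -!lactA !oneform_push mulr1.
  rewrite !scalerA; set c := (X in X *: _).
  by rewrite (_ : c = 1) ?scale1r // -q9 /c; ring.
have qcube_eta : qcube ▷ η = η ◁ qcube :> A1.
  rewrite -[η in LHS](ract1 (A := A)) /qcube -!lactA !oneform_push !mulr1 !qplane_sort.
  rewrite -!ractZr !scalerDr !scalerA -!addrA -!scalerDl.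
  set c := (X in X *: η ◁ _); set d := (X in _ + X *: _).
  have -> : c = 1 by rewrite -q9 /c; ring.
  (* [d] collects the three choices of the x that turns η into ξy. Their sum is a multiple of 1 +
     q^2 + q^4 = 1 + q^2 + q = 0. *)
  have -> : d = 0.
    by apply: (@eq_modq ((q ^+ 2 - 1) * q ^+ 5 * (q ^+ 2 - q + 1))); rewrite /d; ring.
  by rewrite scale0r addr0 scale1r.
rewrite ractDl lactDr !lactA !qcube_central -(lactA a) -(lactA b).
by rewrite qcube_xi qcube_eta !lact_ract.
Qed.

(** Left coefficients of u move to the right through the central one-forms. *)
Lemma qcube_oneform_span (u : A1) :
  exists a b : A, u ◁ qcube = xi_central ◁ a + eta_central ◁ b.
Proof.
have [a [b ->]] := oneform_lspan u.
rewrite ractDl -!lact_ract xi_qcube eta_qcube lactDr.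
rewrite (lact_ract a xi_central) (lact_ract b eta_central) (lact_ract b xi_central).
rewrite (xi_centralP a) (xi_centralP b) (eta_centralP b) !ractA.
exists (a * (y * (y * (x * x))) + b * (q *: (y * (y * (y * x))))), (b * (q *: (y * x))).
by rewrite ractDr addrA addrAC /xi_central !ractA.
Qed.

(* The two bimodule maps A^1 -> A given by (ξ, η) |-> (y^2 x^2, q y^3 x) and
   (0, y x) are jointly injective: they are the coordinates of qcube ▷ u with
   respect to xi_central and eta_central. *)
Lemma oneform_reg (u : A1) : qcube ▷ u = 0 -> u = 0.
Proof.
(* Left divisors of [qcube] can be cancelled on the right; [al] and [ga] are such divisors. *)
have qcube_regr (c d e : A) : c * d = 0 -> d * e = qcube -> c = 0.
  by move=> cd de; apply: qcube_reg; rewrite qcube_central -de mulrA cd mul0r.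
pose al : A := y * (y * (x * x)); pose be : A := q *: (y * (y * (y * x))).
pose ga : A := y * x.
have x_al : x * al = q ^+ 2 *: (al * x) by rewrite /al -!mulrA !qplane_sort.
have y_al : y * al = q *: (al * y).
  by rewrite /al -!mulrA !qplane_sort qqq1 scale1r.
have x_be : x * be = q *: (be * x) + (q ^+ 2 - 1) *: (al * y).
  rewrite /al /be -!mulrA !qplane_sort -scalerDl; congr (_ *: _); ring.
have y_be : y * be = q ^+ 2 *: (be * y).
  rewrite /be -!mulrA !qplane_sort; congr (_ *: _).
  by apply: (@eq_modq (q * (1 - q))); ring.
have x_0 : x * 0 = q ^+ 2 *: ((0 : A) * x) by rewrite mulr0 mul0r scaler0.
have y_0 : y * 0 = q *: ((0 : A) * y) by rewrite mulr0 mul0r scaler0.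
have x_ga : x * ga = q *: (ga * x) + (q ^+ 2 - 1) *: ((0 : A) * y).
  by rewrite /ga mul0r scaler0 addr0 -!mulrA !qplane_sort.
have y_ga : y * ga = q ^+ 2 *: (ga * y).
  by rewrite /ga -!mulrA !qplane_sort -exprSr q3 scale1r.
have [a [b ->]] := oneform_lspan u => zu.
(* This map kills ξ and so isolates b. *)
have := congr1 (oneform_map 0 ga) zu.
rewrite (oneform_map0 x_0 x_ga) // (oneform_mapL x_0 x_ga) //.
rewrite (oneform_mapD x_0 x_ga) // !(oneform_mapL x_0 x_ga) //.
rewrite (oneform_map_xi x_0 x_ga) // (oneform_map_eta x_0 x_ga) // mulr0 add0r.
move/qcube_reg/(qcube_regr b ga (q *: (y * (y * (x * x))))) => b0.
(* Once b = 0, this map isolates a. *)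
have := congr1 (oneform_map al be) zu.
rewrite (oneform_map0 x_al x_be) // (oneform_mapL x_al x_be) //.
rewrite (oneform_mapD x_al x_be) // !(oneform_mapL x_al x_be) //.
rewrite (oneform_map_xi x_al x_be) // (oneform_map_eta x_al x_be) // b0.
  rewrite mul0r addr0.
  move/qcube_reg/(qcube_regr a al (q *: (y * x))) => ->.
    by rewrite !lact0l addr0.
  by rewrite /al -!mulrA !qplane_sort qqq1 scale1r.
by rewrite /ga -!mulrA !qplane_sort qqq1 scale1r.
Qed.

End ThirdRoot.

(** * The exponential as a primitive third root of unity *)

Lemma cexp_third_root (R : realType) (q : R[i]) :
  q = cexp (2 * (pi : R)%:C%C * 'i%C / 3) -> q ^+ 2 + q + 1 = 0.
Proof.
have -> : 2 * (pi : R)%:C%C * 'i%C / 3 = (0 +i* (2 * pi / 3))%C :> R[i].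
  rewrite -!(rmorph_nat (real_complex R)) -fmorphV /=.
  apply/eqP; rewrite eq_complex /= ?rmorph_nat.
  by apply/andP; split; apply/eqP; simpc; field.
rewrite /cexp /= expR0 !mul1r; set t : R := 2 * pi / 3.
set c := cos t; set s := sin t => ->.
(* The values at 3t give q^3 = 1, and sin t > 0 gives q != 1; cancelling q - 1 from q^3 - 1 leaves
   the claim. *)
have ct : cos (t + t + t) = 1
  by rewrite (_ : _ + _ + _ = pi *+ 2) ?cos2pi // /t mulr2n; field.
have st : sin (t + t + t) = 0
  by rewrite (_ : _ + _ + _ = pi *+ 2) ?sin2pi // /t mulr2n; field.
have s0 : s != 0.
  rewrite gt_eqF // sin_gt0_pi // /t; have := pi_gt0 R; lra.
move: ct st; rewrite !(sinD, cosD) -/c -/s => ct st.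
have q3 : (c +i* s)%C ^+ 3 = 1 :> R[i].
  rewrite !exprS expr0 mulr1; simpc; apply/eqP; rewrite eq_complex /=.
  by apply/andP; split; apply/eqP; [rewrite -[RHS]ct|rewrite -[RHS]st]; ring.
have q1 : (c +i* s)%C - 1 != 0 :> R[i].
  by rewrite subr_eq0 eq_complex /= negb_and s0 orbT.
by apply: (mulfI q1); rewrite mulr0; move: q3 => /eqP; rewrite -subr_eq0 => /eqP <-; ring.
Qed.

(** * Bilinearity of the defect of metric compatibility *)

Section Defect.
Context (K : comNzRingType) (q : K).
Local Notation A := (qplane q).
Local Notation A1 := (oneform q).
Context (tau : A1 ⊗ A1 -> A1 ⊗ A1) (g : A1 ⊗ A1 -> A).
Context (nablaL nablaR : A1 -> A1 ⊗_A A1).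
Hypothesis gP : symmetric_metric tau g.
Hypothesis hL : left_connection nablaL.
Hypothesis hR : right_connection nablaR.

Lemma metric_lact a ζ ρ : g ((a ▷ ζ) ⊗ ρ) = a * g (ζ ⊗ ρ).
Proof. by rewrite -{1}(ract1 (A := A) ρ) (metric_bilinear gP) mulr1. Qed.

Lemma metric_ract ζ ρ b : g (ζ ⊗ (ρ ◁ b)) = g (ζ ⊗ ρ) * b.
Proof. by rewrite -{1}(lact1 (A := A) ζ) (metric_bilinear gP) mul1r. Qed.

Lemma gcheck_lact a u ρ : gcheck g ((a ▷ u) ⊗ ρ) = a ▷ gcheck g (u ⊗ ρ).
Proof.
move: u; apply: additive_eq => [u v|u v|α ζ].
- by rewrite lactDr pureKDl (gcheckD gP).
- by rewrite pureKDl (gcheckD gP) lactDr.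
- rewrite -[tpure _ _ α ζ]/(pureA α ζ) -pureAl !(gcheckE gP).
  by rewrite lact_ract.
Qed.

Lemma gcheck_ract u ρ b : gcheck g (u ⊗ (ρ ◁ b)) = gcheck g (u ⊗ ρ) ◁ b.
Proof.
move: u; apply: additive_eq => [u v|u v|α ζ].
- by rewrite pureKDl (gcheckD gP).
- by rewrite pureKDl (gcheckD gP) ractDl.
- rewrite -[tpure _ _ α ζ]/(pureA α ζ) !(gcheckE gP).
  by rewrite metric_ract ractA.
Qed.

Lemma ghat_lact a ζ u : ghat g ((a ▷ ζ) ⊗ u) = a ▷ ghat g (ζ ⊗ u).
Proof.
move: u; apply: additive_eq => [u v|u v|ρ α].
- by rewrite pureKDr (ghatD gP).
- by rewrite pureKDr (ghatD gP) lactDr.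
- rewrite -[tpure _ _ ρ α]/(pureA ρ α) !(ghatE gP).
  by rewrite metric_lact lactA.
Qed.

Lemma ghat_ract ζ u b : ghat g (ζ ⊗ (u ◁ b)) = ghat g (ζ ⊗ u) ◁ b.
Proof.
move: u; apply: additive_eq => [u v|u v|ρ α].
- by rewrite ractDl pureKDr (ghatD gP).
- by rewrite pureKDr (ghatD gP) ractDl.
- rewrite -[tpure _ _ ρ α]/(pureA ρ α) -pureAr !(ghatE gP).
  by rewrite lact_ract.
Qed.

Lemma connectionD (nabla : A1 -> A1 ⊗_A A1) :
  linear nabla -> {morph nabla : ζ ζ' / ζ + ζ'}.
Proof. by move=> H ζ ζ'; have := H 1 ζ ζ'; rewrite !scale1r. Qed.

Definition compat_defect ζ ρ : A1 :=
  qd (g (ζ ⊗ ρ)) - (gcheck g (nablaL ζ ⊗ ρ) + ghat g (ζ ⊗ nablaR ρ)).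

Lemma compat_defect_eq0 ζ ρ :
  compat_defect ζ ρ = 0 <-> metric_compat_at g nablaL nablaR ζ ρ.
Proof.
rewrite /compat_defect /metric_compat_at.
by split=> [/eqP|->]; rewrite ?subrr // subr_eq0 => /eqP.
Qed.

Lemma compat_defectDl ζ ζ' ρ :
  compat_defect (ζ + ζ') ρ = compat_defect ζ ρ + compat_defect ζ' ρ.
Proof.
rewrite /compat_defect (connectionD (left_connection_linear hL)) !pureKDl.
rewrite (metricD gP) (gcheckD gP) (ghatD gP) linearD /=.
by rewrite [X in _ - X]addrACA opprD addrACA.
Qed.

Lemma compat_defectDr ζ ρ ρ' :
  compat_defect ζ (ρ + ρ') = compat_defect ζ ρ + compat_defect ζ ρ'.
Proof.
rewrite /compat_defect (connectionD (right_connection_linear hR)) !pureKDr.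
rewrite (metricD gP) (gcheckD gP) (ghatD gP) linearD /=.
by rewrite [X in _ - X]addrACA opprD addrACA.
Qed.

(** The term da g(ζ,ρ) of d(a g(ζ,ρ)) cancels the value of [gcheck] on da ⊗_A ζ and ρ; all other
    terms are left A-linear in ζ. *)
Lemma compat_defect_lact a ζ ρ :
  compat_defect (a ▷ ζ) ρ = a ▷ compat_defect ζ ρ.
Proof.
rewrite /compat_defect (left_connection_leibniz hL) pureKDl (gcheckD gP).
rewrite (gcheckE gP) gcheck_lact ghat_lact metric_lact qdM.
by rewrite lactDr lactN lactDr -[X in _ - X = _]addrA opprD addrACA subrr add0r.
Qed.

(** Mirror cancellation: g(ζ,ρ) db against the value of [ghat] on ζ and ρ ⊗_A db. *)
Lemma compat_defect_ract ζ ρ b :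
  compat_defect ζ (ρ ◁ b) = compat_defect ζ ρ ◁ b.
Proof.
rewrite /compat_defect (right_connection_leibniz hR) pureKDr (ghatD gP).
rewrite (ghatE gP) gcheck_ract ghat_ract metric_ract qdM.
by rewrite ractDl ractN ractDl [X in _ - X = _]addrA opprD addrACA subrr addr0.
Qed.

End Defect.

(** * From central one-forms to all one-forms *)

Theorem proposition4p6 (R : realType) (q : R[i])
    (hq : q = cexp (2 * (pi : R)%:C%C * 'i%C / 3))
    (tau : oneform q ⊗ oneform q -> oneform q ⊗ oneform q)
    (htau : is_braiding tau)
    (g : oneform q ⊗ oneform q -> qplane q)
    (hg : symmetric_metric tau g)
    (nablaL nablaR : oneform q -> oneform q ⊗_A oneform q)
    (hL : left_connection nablaL) (hR : right_connection nablaR) :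
  (forall ζ ρ : oneform q, bimod_center ζ -> bimod_center ρ ->
     metric_compat_at g nablaL nablaR ζ ρ) <->
  (forall ζ ρ : oneform q, metric_compat_at g nablaL nablaR ζ ρ).
Proof.
split=> [compat ζ ρ|compat ζ ρ _ _]; last exact: compat.
have q1 := cexp_third_root hq.
(* Torsion-freeness is used twice, to supply one factor [qcube] for each argument of the defect. *)
apply/compat_defect_eq0; apply: (oneform_reg q1); apply: (oneform_reg q1).
have defect0 u v : bimod_center u -> bimod_center v ->
    compat_defect g nablaL nablaR u v = 0.
  by move=> ? ?; apply/compat_defect_eq0; apply: compat.
move: (xi_centralP q1) (eta_centralP q1) (qcube_oneform_span q1).
move: (xi_central q) (eta_central q) => u v uZ vZ span.
(* One factor enters the second argument from the right, the other the first argument from the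
   left. *)
rewrite [X in _ ▷ X](qcube_oneform q1) -(compat_defect_ract nablaL hg hR).
rewrite -(compat_defect_lact nablaR hg hL) (qcube_oneform q1).
have [a [b ->]] := span ζ; have [c [d ->]] := span ρ.
(* Coefficients of central forms may stand on either side: on the left they leave the first
   argument, on the right the second. Four defects at pairs of central forms remain. *)
rewrite -!uZ -!vZ !(compat_defectDl nablaR hg hL) !(compat_defect_lact nablaR hg hL).
rewrite !uZ !vZ !(compat_defectDr nablaL hg hR) !(compat_defect_ract nablaL hg hR).
by rewrite !defect0 // !(ract0l, lact0r, addr0).
Qed.
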